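(* Let $\alpha,\beta\in\mathbb{R}$ be arbitrary and let $f:]0,1]\rightarrow\mathbb{R}$ be a function for which $$f(xy)=\left(\frac{x^{\alpha}+x^{\beta}}{2}\right)f(y)+\left(\frac{y^{\alpha}+y^{\beta}}{2}\right)f(x)$$ holds for any $x,y\in ]0,1]$. Then we have the following two possibilities. (i) If $\alpha\neq\beta$, then there exists $c\in\mathbb{R}$ such that $f(x)=c\left(x^{\alpha}-x^{\beta}\right)$ for all $x\in ]0,1]$. (ii) If $\beta=\alpha$, then there exist $c\in\mathbb{R}$ and a logarithmic function $\ell:]0,1]\rightarrow\mathbb{R}$ such that $f(x)=cx^{\alpha}\ell(x)$ for all $x\in ]0,1]$.
   Context: The notation $]a,b]$ denotes the left-open, right-closed interval. A function $\ell:]0,1]\rightarrow\mathbb{R}$ is called logarithmic if $\ell(xy)=\ell(x)+\ell(y)$ for all $x,y\in ]0,1]$ (no regularity is assumed). *)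

(* Defs.v *)
From HB Require Import structures.
From mathcomp Require Import all_boot all_order all_algebra.
From mathcomp Require Import all_classical all_reals all_analysis.

Set Implicit Arguments.
Unset Strict Implicit.
Unset Printing Implicit Defensive.

Import Order.TTheory GRing.Theory Num.Theory.
Local Open Scope ring_scope.

(* A function ]0,1] -> R is represented by a total function R -> R of which
   only the values on ]0,1] are ever constrained or used. *)
Definition logarithmic (R : realType) (l : R -> R) : Prop :=
  forall x y : R, x \in `]0, 1] -> y \in `]0, 1] -> l (x * y) = l x + l y.

(* Main.v *)
Require Import Defs.
From HB Require Import structures.
From mathcomp Require Import all_boot all_order all_algebra.
From mathcomp Require Import all_classical all_reals all_analysis.
From mathcomp Require Import ring lra.

Set Implicit Arguments.
Unset Strict Implicit.
Unset Printing Implicit Defensive.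

Import Order.TTheory GRing.Theory Num.Theory.
Local Open Scope ring_scope.

(** Write [g x] for the mean of [x `^ alpha] and [x `^ beta], and [h x] for
    their difference.  The equation says that [f] satisfies the sine-type
    addition law [f (x * y) = g x * f y + g y * f x].

    Expanding [f (x * y * z)] by associativity in two ways gives
    [(g (x * y) - g x * g y) * f z = (g (y * z) - g y * g z) * f x]; this is
    [sine_law_defect].  Since [g] is a mean of two multiplicative functions,
    its multiplicativity defect factors: [g (x * y) - g x * g y = h x * h y / 4]
    ([mean_mul_defect]).  If [alpha <> beta], then [h] does not vanish at [1 / 2]
    ([powR_half_inj]), and taking [y = z = 1 / 2] shows that [f] is a multiple
    of [h].

    If [beta = alpha], then [g] is itself the multiplicative, nowhere zero
    function [x `^ alpha], and dividing the equation by [g (x * y)] turns it into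
    the additivity of the quotient of [f] by [g]. *)

Lemma mul_in_itv01 (R : realType) (x y : R) :
  x \in `]0, 1] -> y \in `]0, 1] -> x * y \in `]0, 1].
Proof.
rewrite !in_itv /= => /andP[x0 x1] /andP[y0 y1].
by rewrite mulr_gt0 //= mulr_ile1 // ltW.
Qed.

(** The two expansions of [f (x * y * z)] share the term [g x * g z * f y],
    which cancels. *)
Lemma sine_law_defect (R : realType) (f g : R -> R)
  (hf : forall x y : R, x \in `]0, 1] -> y \in `]0, 1] ->
    f (x * y) = g x * f y + g y * f x) (x y z : R) :
  x \in `]0, 1] -> y \in `]0, 1] -> z \in `]0, 1] ->
  (g (x * y) - g x * g y) * f z = (g (y * z) - g y * g z) * f x.
Proof.
move=> hx hy hz.
have eq_l : f (x * y * z)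
    = g (x * y) * f z + g z * (g x * f y + g y * f x).
  by rewrite hf ?mul_in_itv01 // (hf x).
have eq_r : f (x * y * z)
    = g x * (g y * f z + g z * f y) + g (y * z) * f x.
  by rewrite -mulrA hf ?mul_in_itv01 // (hf y).
by move: eq_l; rewrite eq_r => eq_lr; lra.
Qed.

Lemma mean_mul_defect (R : realType) (a b x y : R) : 0 <= x -> 0 <= y ->
  ((x * y) `^ a + (x * y) `^ b) / 2
    - (x `^ a + x `^ b) / 2 * ((y `^ a + y `^ b) / 2)
  = (x `^ a - x `^ b) * (y `^ a - y `^ b) / 4.
Proof. by move=> x0 y0; rewrite !powRM //; field. Qed.

Lemma powR_half_inj (R : realType) : injective (fun a : R => 2^-1 `^ a).
Proof.
move=> a b /(congr1 (@ln R)); rewrite !ln_powR; apply: mulIf.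
by rewrite lt_eqF // ln_lt0 // invr_gt0 invf_lt1 ?ltr0n ?ltr1n.
Qed.

Theorem corollary2p4 (R : realType) (alpha beta : R) (f : R -> R)
  (hf : forall x y : R, x \in `]0, 1] -> y \in `]0, 1] ->
    f (x * y) = (x `^ alpha + x `^ beta) / 2 * f y
              + (y `^ alpha + y `^ beta) / 2 * f x) :
  (alpha <> beta ->
    exists c : R, forall x : R, x \in `]0, 1] ->
      f x = c * (x `^ alpha - x `^ beta))
  /\
  (beta = alpha ->
    exists (c : R) (l : R -> R), logarithmic l /\
      forall x : R, x \in `]0, 1] -> f x = c * x `^ alpha * l x).
Proof.
split=> [ab | ba].
- have half01 : (2^-1 : R) \in `]0, 1].
    by rewrite in_itv /= invr_gt0 invf_le1 ?ltr0n ?ler1n.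
  set d : R := 2^-1 `^ alpha - 2^-1 `^ beta.
  have d0 : d != 0 by rewrite subr_eq0; apply/eqP => /powR_half_inj.
  exists (f 2^-1 / d) => x hx.
  have := sine_law_defect
    (g := fun t => (t `^ alpha + t `^ beta) / 2) hf hx half01 half01.
  have x0 : 0 <= x by move: hx; rewrite in_itv /= => /andP[/ltW].
  rewrite !mean_mul_defect ?invr_ge0 ?ler0n // -/d => eq_d.
  (* Both sides of [eq_d] contain the factor [d / 4], coming from the middle
     variable. *)
  apply: (mulfI (mulf_neq0 d0 d0)).
  have -> : d * d * f x = 4 * (d * d / 4 * f x) by field.
  by rewrite -eq_d; field.
- subst beta.
  exists 1, (fun x => f x / x `^ alpha).
  have pow0 (x : R) : x \in `]0, 1] -> x `^ alpha != 0.
    by rewrite in_itv /= => /andP[x0 _]; rewrite gt_eqF // powR_gt0.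
  split=> [x y hx hy | x hx]; last by field; exact: pow0.
  have [x0 y0] : 0 <= x /\ 0 <= y.
    by move: hx hy; rewrite !in_itv /= => /andP[/ltW ? _] /andP[/ltW ? _].
  rewrite hf // powRM //; field.
  by rewrite !pow0.
Qed.
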